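(* Let $k$ be a commutative ring and $A$ a commutative $k$-algebra. Any left (resp. right) HS-module $(E,\Psi)$ over $A/k$ carries a natural left (resp. right) integrable connection $\nabla:\mathrm{Der}_k(A)\to\mathrm{End}_k(E)$ (resp. $\nabla:\mathrm{Der}_k(A)\to\mathrm{End}_k(E)^{\mathrm{opp}}$), given by $$\Psi^1_{\{0,1\}}(\mathrm{Id}+\delta s)=1+\nabla(\delta)s\qquad\text{for all }\delta\in\mathrm{Der}_k(A).$$
   Context: Throughout, $k$ is a commutative ring and $A$ a commutative $k$-algebra; $\mathbb{N}=\{0,1,2,\dots\}$; $\mathbf{s}=\{s_1,\dots,s_p\}$, $\mathbf{t}=\{t_1,\dots,t_q\}$ are sets of variables (for $p=1$ the variable is written $s$). Co-ideals and truncated series. $\mathbb{N}^p$ has the componentwise partial order. A co-ideal of $\mathbb{N}^p$ is a subset $\Delta$ such that $\alpha\in\Delta$, $\alpha'\le\alpha$ imply $\alpha'\in\Delta$. For an abelian group $M$ and a non-empty co-ideal $\Delta$, $M[[\mathbf{s}]]_\Delta$ is the quotient of $M[[\mathbf{s}]]$ by the series with $m_\alpha=0$ for all $\alpha\in\Delta$; its elements are written $\sum_{\alpha\in\Delta}m_\alpha\mathbf{s}^\alpha$. If $R$ is a ring, $R[[\mathbf{s}]]_\Delta$ is a ring (the variables are central), and $\mathcal{U}^p(R;\Delta)$ is the multiplicative group of $r\in R[[\mathbf{s}]]_\Delta$ with $r_0=1$. A $k$-algebra over $A$ is a not necessarily commutative $k$-algebra $R$ with a $k$-algebra map $\iota:A\to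 R$; elements of $A$ act on $R$ on both sides through $\iota$, and $a\in A$ is also written for $\iota(a)$. For an $A$-module $E$, $\mathrm{End}_k(E)$ and its opposite $\mathrm{End}_k(E)^{\mathrm{opp}}$ are $k$-algebras over $A$ via $a\mapsto(e\mapsto ae)$. Substitution maps. A substitution map $\varphi:A[[\mathbf{s}]]_\Delta\to A[[\mathbf{t}]]_\Omega$ (with $\Delta\subset\mathbb{N}^p$, $\Omega\subset\mathbb{N}^q$ non-empty co-ideals) is an $A$-algebra map such that each $\varphi(s_i)$ has zero constant term. For $r=\sum r_\alpha\mathbf{s}^\alpha\in R[[\mathbf{s}]]_\Delta$, $\varphi\bullet r:=\sum_\alpha\varphi(\mathbf{s}^\alpha)r_\alpha\in R[[\mathbf{t}]]_\Omega$. Hasse–Schmidt derivations. $\mathrm{HS}^p_k(A;\Delta)$ is the set of families $D=(D_\alpha)_{\alpha\in\Delta}$ of $k$-linear maps $D_\alpha:A\to A$ with $D_0=\mathrm{Id}$ and $D_\alpha(xy)=\sum_{\beta+\gamma=\alpha}D_\beta(x)D_\gamma(y)$. Identifying $D$ with $\sum_{\alpha\in\Delta}D_\alpha\mathbf{s}^\alpha$, it is a subgroup of $\mathcal{U}^p(\mathrm{End}_k(A);\Delta)$, and $\varphi\bullet D\in\mathrm{HS}^q_k(A;\Omega)$ for every substitution map $\varphi:A[[\mathbf{s}]]_\Delta\to A[[\mathbf{t}]]_\Omega$ with $\Delta\subset\mathbb{N}^p$, $\Omega\subset\mathbb{N}^q$ non-empty co-ideals (known). In particular $\mathrm{HS}^1_k(A;\{0,1\})=\{\mathrm{Id}+\delta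 s:\delta\in\mathrm{Der}_k(A)\}$. HS-structures. An HS-structure on a $k$-algebra $R$ over $A$ (over $A/k$) is a system of maps $\Psi^p_\Delta:\mathrm{HS}^p_k(A;\Delta)\to\mathcal{U}^p(R;\Delta)$, for $p\in\mathbb{N}$ and $\Delta\subset\mathbb{N}^p$ a non-empty co-ideal, such that: (i) each $\Psi^p_\Delta$ is a group homomorphism; (ii) $\Psi^p_\Delta(D)\,a=\left(\sum_{\alpha\in\Delta}D_\alpha(a)\mathbf{s}^\alpha\right)\Psi^p_\Delta(D)$ for all $D\in\mathrm{HS}^p_k(A;\Delta)$, $a\in A$; (iii) $\Psi^q_\Omega(\varphi\bullet D)=\varphi\bullet\Psi^p_\Delta(D)$ for every substitution map $\varphi:A[[\mathbf{s}]]_\Delta\to A[[\mathbf{t}]]_\Omega$ and every $D\in\mathrm{HS}^p_k(A;\Delta)$. A left (resp. right) HS-module over $A/k$ is an $A$-module $E$ with an HS-structure on $\mathrm{End}_k(E)$ (resp. on $\mathrm{End}_k(E)^{\mathrm{opp}}$) over $A/k$. A map $\nabla:\mathrm{Der}_k(A)\to R$ to a $k$-algebra $R$ over $A$ is LR-admissible if it is left $A$-linear, $\nabla(\delta)a=a\nabla(\delta)+\delta(a)1_R$, and $\nabla([\delta,\delta'])=[\nabla(\delta),\nabla(\delta')]$ for all $\delta,\delta'\in\mathrm{Der}_k(A)$, $a\in A$ (operations in $R$). A left (resp. right) integrable connection on an $A$-module $E$ over $A/k$ is an LR-admissible map $\nabla:\mathrm{Der}_k(A)\to\mathrm{End}_k(E)$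 (resp. $\mathrm{Der}_k(A)\to\mathrm{End}_k(E)^{\mathrm{opp}}$). *)

(* Defs.v *)
From HB Require Import structures.
From mathcomp Require Import all_boot all_order all_algebra.
From mathcomp Require Import boolp.
From mathcomp Require Import ssrcomplements mpoly zify.

Set Implicit Arguments.
Unset Strict Implicit.
Unset Printing Implicit Defensive.

Import GRing.Theory.
Local Open Scope ring_scope.

(* Rings are [pzRingType]s and [comPzRingType]s, so that the zero ring is allowed (e.g. End_k(E) for E = 0). A commutative k-algebra A is given
   by its structure morphism kA : {rmorphism k -> A}, because [comAlgType k]
   only covers nontrivial algebras. *)

(* -------------------------------------------------------------------- *)
(* N^p is the type 'X_{1..p} of exponents, with (_ <= _)%MM as
   componentwise order and [mdeg a] = a_1 + ... + a_p. *)

Record coideal (p : nat) := Coideal {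
  coideal_mem :> 'X_{1..p} -> Prop;
  coideal_down : forall a b, coideal_mem a -> (b <= a)%MM -> coideal_mem b;
  coideal_neq0 : exists a, coideal_mem a
}.

(* The bounds in the index type only serve to make it finite: if a = b + c,
   then b and c have degree at most mdeg a. *)
Definition conv (R : pzRingType) p (f g : 'X_{1..p} -> R) (a : 'X_{1..p}) : R :=
  \sum_(b : 'X_{1..p < (mdeg a).+1, (mdeg a).+1} | a == (b.1 + b.2)%MM)
    f b.1 * g b.2.

(* M[[s]]_Delta: every class of M[[s]] modulo the series that vanish on Delta
   is represented by its unique member supported in Delta. *)
Record tseries (M : zmodType) p (Delta : coideal p) := TSeries {
  tcoef :> 'X_{1..p} -> M;
  tcoef_out : forall a, ~ Delta a -> tcoef a = 0
}.

Section TruncatedModule.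
Variables (M : zmodType) (p : nat) (Delta : coideal p).
Implicit Types (f g : 'X_{1..p} -> M) (r s : tseries M Delta).

Lemma tseriesP r s : (forall a, Delta a -> r a = s a) -> r = s.
Proof.
case: r s => [f hf] [g hg] /= efg.
have e : f = g.
  by apply/funext => a; case: (pselect (Delta a)) => [/efg|na] //; rewrite hf ?hg.
by rewrite -e in hg *; congr TSeries; apply: Prop_irrelevance.
Qed.

Fact trunc_out f a : ~ Delta a -> (if `[< Delta a >] then f a else 0) = 0.
Proof. by move=> /asboolPn/negbTE ->. Qed.

(* The projection M[[s]] -> M[[s]]_Delta. *)
Definition trunc f : tseries M Delta := TSeries (@trunc_out f).

Lemma truncE f a : Delta a -> trunc f a = f a.
Proof. by move=> ?; rewrite /= asboolT. Qed.

HB.instance Definition _ := gen_eqMixin (tseries M Delta).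
HB.instance Definition _ := gen_choiceMixin (tseries M Delta).

Definition tadd r s := trunc (fun a => r a + s a).
Definition topp r := trunc (fun a => - r a).
Definition tzero := trunc (fun=> 0).

Fact taddA : associative tadd.
Proof. by move=> r s t; apply: tseriesP => a da; rewrite !truncE // addrA. Qed.
Fact taddC : commutative tadd.
Proof. by move=> r s; apply: tseriesP => a da; rewrite !truncE // addrC. Qed.
Fact tadd0 : left_id tzero tadd.
Proof. by move=> r; apply: tseriesP => a da; rewrite !truncE // add0r. Qed.
Fact taddN : left_inverse tzero topp tadd.
Proof. by move=> r; apply: tseriesP => a da; rewrite !truncE // addNr. Qed.

HB.instance Definition _ :=
  GRing.isZmodule.Build (tseries M Delta) taddA taddC tadd0 taddN.

Lemma tcoefD r s a : (r + s) a = r a + s a.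
Proof.
by case: (pselect (Delta a)) => da; [exact: truncE | rewrite !tcoef_out ?addr0].
Qed.

Lemma tcoefN r a : (- r) a = - r a.
Proof.
by case: (pselect (Delta a)) => da; [exact: truncE | rewrite !tcoef_out ?oppr0].
Qed.

Lemma tcoef0 a : (0 : tseries M Delta) a = 0.
Proof. by case: (pselect (Delta a)) => da; [exact: truncE | exact: tcoef_out]. Qed.

Definition tconst (m : M) : tseries M Delta :=
  trunc (fun a => if a == 0%MM then m else 0).

End TruncatedModule.

Section Convolution.
Variables (R : pzRingType) (p : nat).
Implicit Types (f g h : 'X_{1..p} -> R) (a : 'X_{1..p}).

Lemma sum_split (G : 'X_{1..p} -> 'X_{1..p} -> R) a n : (mdeg a < n)%N ->
  \sum_(b : 'X_{1..p < (mdeg a).+1, (mdeg a).+1} | a == (b.1 + b.2)%MM)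
    G b.1 b.2 =
  \sum_(b : 'X_{1..p < n} | (b <= a)%MM) G b (a - b)%MM.
Proof.
move=> lt_an; pose T0 := 'X_{1..p < (mdeg a).+1}.
rewrite -(pair_big_dep xpredT (fun b c : T0 => a == (b + c)%MM)
            (fun b c : T0 => G b c)) /=.
transitivity (\sum_(b : T0 | (b <= a)%MM) G b (a - b)%MM).
  rewrite [LHS](bigID (fun b : T0 => (b <= a)%MM)) /= addrC big1 ?add0r.
    apply: eq_bigr => b le_ba.
    have pr : (mdeg (a - b)%MM < (mdeg a).+1)%N by rewrite ltnS mdegB.
    rewrite (big_pred1 (BMultinom pr)) //= => c /=.
    rewrite bmeqP /=; apply/eqP/eqP => e; apply/mnmP => i;
      by move/mnmP/(_ i): e; move/mnm_lepP/(_ i): le_ba; rewrite !mnmE; lia.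
  move=> b nba; apply: big_pred0 => c; apply: contraNF nba => /eqP e.
  by rewrite [X in (_ <= X)%MM]e lem_addr.
pose I0 : subFinType _ := T0; pose In : subFinType _ := 'X_{1..p < n}.
pose Gb (b : 'X_{1..p}) := G b (a - b)%MM.
rewrite (big_sub_widen I0 In (fun b => (b <= a)%MM) Gb) /=; last first.
  by move=> x /leq_trans; apply.
apply: eq_bigl => b; case: (boolP (_ <= _)%MM) => //= le_ba.
by rewrite ltnS -[in X in (_ <= X)%N](submK le_ba) mdegD leq_addl.
Qed.

Lemma conv_lin f g a n : (mdeg a < n)%N ->
  conv f g a = \sum_(b : 'X_{1..p < n} | (b <= a)%MM) f b * g (a - b)%MM.
Proof. exact: (sum_split (fun b c => f b * g c)). Qed.

Lemma conv_linr f g a n : (mdeg a < n)%N ->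
  conv f g a = \sum_(b : 'X_{1..p < n} | (b <= a)%MM) f (a - b)%MM * g b.
Proof.
move=> lt_an; rewrite -(sum_split (fun b c => f c * g b) lt_an) /conv.
pose sw (b : 'X_{1..p < (mdeg a).+1, (mdeg a).+1}) := (b.2, b.1).
rewrite (reindex_inj (h := sw)) /=; last by move=> [b c] [b' c'] [-> ->].
by apply: eq_bigl => b; rewrite addmC.
Qed.

Lemma convA f g h : conv f (conv g h) =1 conv (conv f g) h.
Proof.
move=> a; pose n := (mdeg a).+1.
have lt_n b : (mdeg (a - b)%MM < n)%N by rewrite ltnS mdegB.
rewrite (@conv_lin _ _ a n) // (@conv_linr _ _ a n) //.
pose T := 'X_{1..p < n}.
pose F (b c : 'X_{1..p}) := f b * (g (a - b - c)%MM * h c).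
transitivity (\sum_(b : T | (b <= a)%MM) \sum_(c : T | (c <= a - b)%MM) F b c).
  by apply: eq_bigr => b _; rewrite (@conv_linr _ _ _ n) // big_distrr.
pose P (c : T) := (c <= a)%MM.
rewrite (exchange_big_dep P) //= {}/P; last first.
  by move=> b c _ /lepm_trans; apply; apply: lem_subr.
apply: eq_bigr => c /mnm_lepP le_ca.
transitivity (\sum_(b : T | (b <= a - c)%MM) F b c).
  apply: eq_bigl => b; apply/andP/idP.
    case=> /mnm_lepP le1 /mnm_lepP le2; apply/mnm_lepP => i.
    by move: (le1 i) (le2 i) (le_ca i); rewrite !mnmBE; lia.
  move=> /mnm_lepP le1; split; apply/mnm_lepP => i;
    by move: (le1 i) (le_ca i); rewrite !mnmBE; lia.
rewrite (@conv_lin _ _ _ n) // big_distrl /=.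
by apply: eq_bigr => b _; rewrite /F !mulrA !submDA addmC.
Qed.

Lemma conv_monom f (x a : 'X_{1..p}) :
  conv (fun b => if b == x then 1 else 0) f a =
  if (x <= a)%MM then f (a - x)%MM else 0.
Proof.
rewrite (@conv_lin _ _ a (mdeg a).+1) //; case: ifP => [lexa|nlexa].
  have px : (mdeg x < (mdeg a).+1)%N.
    by rewrite ltnS -(submK lexa) mdegD leq_addl.
  rewrite (bigD1 (BMultinom px)) //= eqxx mul1r big1 ?addr0 // => b /andP[_].
  by rewrite bmeqP /= => /negbTE ->; rewrite mul0r.
rewrite big1 // => b leba; case: eqP => [e|_]; last by rewrite mul0r.
by rewrite -e leba in nlexa.
Qed.

Lemma conv1f f : conv (fun a => if a == 0%MM then 1 else 0) f =1 f.
Proof.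
move=> a; rewrite conv_monom; case: ifP => [_|/mnm_lepP[] i].
  by congr f; apply/mnmP => i; rewrite mnmBE mnm0E subn0.
by rewrite mnm0E.
Qed.

Lemma convf1 f : conv f (fun a => if a == 0%MM then 1 else 0) =1 f.
Proof.
move=> a; rewrite (@conv_linr _ _ a (mdeg a).+1) //.
rewrite (bigD1 (bm0 : 'X_{1..p < (mdeg a).+1})) /=; last first.
  by apply/mnm_lepP => i; rewrite mnm0E.
rewrite eqxx mulr1 big1 ?addr0 => [|b /andP[_]]; last first.
  by rewrite bmeqP /= => /negbTE ->; rewrite mulr0.
by congr f; apply/mnmP => i; rewrite mnmBE mnm0E subn0.
Qed.

Lemma convDl f g h : conv (fun a => f a + g a) h =1 (fun a => conv f h a + conv g h a).
Proof. by move=> a; rewrite -big_split; apply: eq_bigr => b _; rewrite mulrDl. Qed.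

Lemma convDr f g h : conv f (fun a => g a + h a) =1 (fun a => conv f g a + conv f h a).
Proof. by move=> a; rewrite -big_split; apply: eq_bigr => b _; rewrite mulrDr. Qed.

End Convolution.

Section TruncatedRing.
Variables (R : pzRingType) (p : nat) (Delta : coideal p).
Implicit Types (f g : 'X_{1..p} -> R) (r s t : tseries R Delta).

Lemma eq_conv f f' g g' a : Delta a ->
    (forall b, Delta b -> f b = f' b) -> (forall b, Delta b -> g b = g' b) ->
  conv f g a = conv f' g' a.
Proof.
move=> da ef eg; apply: eq_bigr => -[b c] /= /eqP e.
by rewrite ef ?eg //; apply: coideal_down da _;
  rewrite [X in (_ <= X)%MM]e ?lem_addr // addmC lem_addr.
Qed.

Definition tmul r s : tseries R Delta := trunc Delta (conv r s).
Definition tone : tseries R Delta := tconst Delta 1.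

Fact tmulA : associative tmul.
Proof.
move=> r s t; apply: tseriesP => a da; rewrite !truncE //.
rewrite (@eq_conv _ r _ (conv s t)) ?convA //; last by move=> b db; rewrite truncE.
by apply: eq_conv => // b db; rewrite truncE.
Qed.

Fact tmul1r : left_id tone tmul.
Proof.
move=> r; apply: tseriesP => a da; rewrite truncE // -[RHS]conv1f.
by apply: eq_conv => // b db; rewrite truncE.
Qed.

Fact tmulr1 : right_id tone tmul.
Proof.
move=> r; apply: tseriesP => a da; rewrite truncE // -[RHS]convf1.
by apply: eq_conv => // b db; rewrite truncE.
Qed.

Fact tmulDl : left_distributive tmul +%R.
Proof.
move=> r s t; apply: tseriesP => a da; rewrite tcoefD !truncE // -convDl.
by apply: eq_conv => // b _; rewrite tcoefD.
Qed.

Fact tmulDr : right_distributive tmul +%R.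
Proof.
move=> r s t; apply: tseriesP => a da; rewrite tcoefD !truncE // -convDr.
by apply: eq_conv => // b _; rewrite tcoefD.
Qed.

HB.instance Definition _ := GRing.Zmodule_isPzRing.Build (tseries R Delta)
  tmulA tmul1r tmulr1 tmulDl tmulDr.

Lemma tcoefM r s a : Delta a -> (r * s) a =
  \sum_(b : 'X_{1..p < (mdeg a).+1, (mdeg a).+1} | a == (b.1 + b.2)%MM)
    r b.1 * s b.2.
Proof. exact: truncE. Qed.

Definition tmonom (a : 'X_{1..p}) : tseries R Delta :=
  trunc Delta (fun b => if b == a then 1 else 0).

Definition tvar (i : 'I_p) : tseries R Delta := tmonom U_(i)%MM.

End TruncatedRing.

Arguments tvar {R p Delta} i.
Arguments tmonom {R p Delta} a.
Arguments tconst {M p Delta} m.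

(* -------------------------------------------------------------------- *)
Record subst_map (A : comPzRingType) p (Delta : coideal p) q (Omega : coideal q) :=
  SubstMap {
    subst_fun :> {rmorphism tseries A Delta -> tseries A Omega};
    subst_const : forall a : A, subst_fun (tconst a) = tconst a;
    subst_var0 : forall i, subst_fun (tvar i) 0%MM = 0
  }.

(* A k-algebra over A. Since iota : A -> R is a map of k-algebras, the
   k-algebra structure of R is the composite k -> A -> R, whose image has to be
   central. *)
Record algOver (k A : comPzRingType) (kA : {rmorphism k -> A}) := AlgOver {
  alg_ring :> pzRingType;
  iota : {rmorphism A -> alg_ring};
  iota_central : forall (c : k) (x : alg_ring), iota (kA c) * x = x * iota (kA c)
}.

(* phi \bullet r = \sum_a phi(s^a) r_a. The terms with mdeg a > mdeg b do not
   contribute to the coefficient of t^b, see [subst_monom_eq0] below. *)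
Definition subst_series (k A : comPzRingType) (kA : {rmorphism k -> A})
    (R : algOver kA) p (Delta : coideal p) q (Omega : coideal q)
    (phi : subst_map A Delta Omega) (r : tseries R Delta) : tseries R Omega :=
  trunc Omega (fun b : 'X_{1..q} =>
    \sum_(a : 'X_{1..p < (mdeg b).+1}) iota R (phi (tmonom a) b) * r a).

Lemma subst_monom_eq0 (A : comPzRingType) p (Delta : coideal p)
    q (Omega : coideal q) (phi : subst_map A Delta Omega) a b :
  (mdeg b < mdeg a)%N -> phi (tmonom a) b = 0.
Proof.
have [n] := ubnP (mdeg a); elim: n a b => // n IHn a b ltan ltba.
have [i ai] : exists i, (U_(i) <= a)%MM.
  have nza : a != 0%MM by apply: contraTneq ltba => ->; rewrite mdeg0.
  have [i ai] : exists i, a i != 0%N.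
    apply/existsP; rewrite -negb_forall; apply: contra nza => /forallP a0.
    by apply/eqP/mnmP => i; rewrite mnm0E; apply/eqP/a0.
  exists i; apply/mnm_lepP => j; rewrite mnm1E; case: eqP => // <-.
  by rewrite lt0n.
have ea := submK ai; set a' := (a - U_(i))%MM in ea.
have dega : mdeg a = (mdeg a').+1 by rewrite -ea mdegD mdeg1 addn1.
have -> : tmonom a = tvar i * tmonom a' :> tseries A Delta.
  apply: tseriesP => c dc; rewrite tcoefM // truncE //.
  transitivity (conv (fun b => if b == U_(i)%MM then 1 else 0)
                     (fun b => if b == a' then 1 else 0 : A) c).
    rewrite conv_monom; case: (eqVneq c a) => [->|nca]; first by rewrite ai eqxx.
    case: ifP => // le_ic; case: eqP => // e.
    by case/negP: nca; rewrite -(submK le_ic) e ea.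
  by apply: eq_conv dc _ _ => d dd; rewrite truncE.
case: (pselect (Omega b)) => [ob|nob]; last by rewrite tcoef_out.
rewrite rmorphM tcoefM // big1 // => -[c d] /= /eqP eb.
have [c0|c_neq0] := eqVneq (c : 'X_{1..q}) 0%MM.
  by rewrite c0 subst_var0 mul0r.
rewrite [X in _ * X]IHn ?mulr0 //; first by rewrite -ltnS -dega.
have := congr1 mdeg eb; rewrite mdegD => eb'.
by move: ltba c_neq0; rewrite dega -mdeg_eq0; lia.
Qed.

(* -------------------------------------------------------------------- *)
(* End_k(E) for an A-module E, k acting on E through kA. *)
Record kend (k A : comPzRingType) (kA : {rmorphism k -> A}) (E : lmodType A) :=
  KEnd {
    kend_fun :> E -> E;
    kendD : {morph kend_fun : x y / x + y};
    kendZ : forall c : k, {morph kend_fun : x / kA c *: x}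
  }.

Section Endomorphisms.
Variables (k A : comPzRingType) (kA : {rmorphism k -> A}) (E : lmodType A).
Local Notation End := (kend kA E).
Implicit Types (f g h : End).

Lemma kendP f g : (forall e, f e = g e) -> f = g.
Proof.
case: f g => [f fD fZ] [g gD gZ] /= /funext efg.
rewrite -efg in gD gZ *.
by congr KEnd; apply: Prop_irrelevance.
Qed.

HB.instance Definition _ := gen_eqMixin End.
HB.instance Definition _ := gen_choiceMixin End.

Fact kend_addD f g : {morph (fun e => f e + g e) : x y / x + y}.
Proof. by move=> x y; rewrite !kendD addrACA. Qed.
Fact kend_addZ f g c : {morph (fun e => f e + g e) : x / kA c *: x}.
Proof. by move=> x; rewrite !kendZ scalerDr. Qed.
Definition kend_add f g := KEnd (kend_addD f g) (kend_addZ f g).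

Fact kend_oppD f : {morph (fun e => - f e) : x y / x + y}.
Proof. by move=> x y; rewrite kendD opprD. Qed.
Fact kend_oppZ f c : {morph (fun e => - f e) : x / kA c *: x}.
Proof. by move=> x; rewrite kendZ scalerN. Qed.
Definition kend_opp f := KEnd (kend_oppD f) (kend_oppZ f).

Fact kend_zeroD : {morph (fun _ : E => 0 : E) : x y / x + y}.
Proof. by move=> x y; rewrite addr0. Qed.
Fact kend_zeroZ c : {morph (fun _ : E => 0 : E) : x / kA c *: x}.
Proof. by move=> x; rewrite scaler0. Qed.
Definition kend_zero := KEnd kend_zeroD kend_zeroZ.

Fact kend_addA : associative kend_add.
Proof. by move=> f g h; apply: kendP => e /=; rewrite addrA. Qed.
Fact kend_addC : commutative kend_add.
Proof. by move=> f g; apply: kendP => e /=; rewrite addrC. Qed.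
Fact kend_add0 : left_id kend_zero kend_add.
Proof. by move=> f; apply: kendP => e /=; rewrite add0r. Qed.
Fact kend_addN : left_inverse kend_zero kend_opp kend_add.
Proof. by move=> f; apply: kendP => e /=; rewrite addNr. Qed.

HB.instance Definition _ :=
  GRing.isZmodule.Build End kend_addA kend_addC kend_add0 kend_addN.

Fact kend_compD f g : {morph (fun e => f (g e)) : x y / x + y}.
Proof. by move=> x y; rewrite !kendD. Qed.
Fact kend_compZ f g c : {morph (fun e => f (g e)) : x / kA c *: x}.
Proof. by move=> x; rewrite !kendZ. Qed.
Definition kend_comp f g := KEnd (kend_compD f g) (kend_compZ f g).

Fact kend_idD : {morph (fun e : E => e) : x y / x + y}. Proof. by []. Qed.
Fact kend_idZ c : {morph (fun e : E => e) : x / kA c *: x}. Proof. by []. Qed.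
Definition kend_id := KEnd kend_idD kend_idZ.

Fact kend_compA : associative kend_comp.
Proof. by move=> f g h; apply: kendP. Qed.
Fact kend_comp1f : left_id kend_id kend_comp.
Proof. by move=> f; apply: kendP. Qed.
Fact kend_compf1 : right_id kend_id kend_comp.
Proof. by move=> f; apply: kendP. Qed.
Fact kend_compDl : left_distributive kend_comp +%R.
Proof. by move=> f g h; apply: kendP. Qed.
Fact kend_compDr : right_distributive kend_comp +%R.
Proof. by move=> f g h; apply: kendP => e /=; rewrite kendD. Qed.

HB.instance Definition _ := GRing.Zmodule_isPzRing.Build End
  kend_compA kend_comp1f kend_compf1 kend_compDl kend_compDr.

Fact kend_homothetyD a : {morph (fun e : E => a *: e) : x y / x + y}.
Proof. by move=> x y; rewrite scalerDr. Qed.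
Fact kend_homothetyZ a c : {morph (fun e : E => a *: e) : x / kA c *: x}.
Proof. by move=> x; rewrite !scalerA mulrC. Qed.
Definition kend_homothety (a : A) : End :=
  KEnd (kend_homothetyD a) (kend_homothetyZ a).

Fact kend_homothety_sub : {morph kend_homothety : a b / a - b}.
Proof. by move=> a b; apply: kendP => e /=; rewrite scalerBl. Qed.
Fact kend_homothety_mul : monoid_morphism kend_homothety.
Proof.
by split=> [|a b]; apply: kendP => e /=; rewrite ?scale1r ?scalerA.
Qed.

HB.instance Definition _ :=
  GRing.isZmodMorphism.Build A End kend_homothety kend_homothety_sub.
HB.instance Definition _ :=
  GRing.isMonoidMorphism.Build A End kend_homothety kend_homothety_mul.

Fact kend_central c f : kend_homothety (kA c) * f = f * kend_homothety (kA c).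
Proof. by apply: kendP => e /=; rewrite kendZ. Qed.

Definition endAlg : algOver kA :=
  @AlgOver k A kA End kend_homothety kend_central.

Definition kend_homothety_opp (a : A) : End^c := kend_homothety a.

Fact kend_homothety_opp_sub : {morph kend_homothety_opp : a b / a - b}.
Proof. exact: kend_homothety_sub. Qed.
Fact kend_homothety_opp_mul : monoid_morphism kend_homothety_opp.
Proof.
split=> [|a b]; first exact: (rmorph1 kend_homothety).
by rewrite mulrC; exact: (rmorphM kend_homothety b a).
Qed.

HB.instance Definition _ :=
  GRing.isZmodMorphism.Build A End^c kend_homothety_opp kend_homothety_opp_sub.
HB.instance Definition _ :=
  GRing.isMonoidMorphism.Build A End^c kend_homothety_opp kend_homothety_opp_mul.

Fact kend_central_opp c (f : End^c) :
  kend_homothety_opp (kA c) * f = f * kend_homothety_opp (kA c).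
Proof. exact: (esym (kend_central c f)). Qed.

Definition endOppAlg : algOver kA :=
  @AlgOver k A kA End^c kend_homothety_opp kend_central_opp.

Definition kend_scale (a : A) f : End := kend_homothety a * f.

Fact kend_scaleA a b f : kend_scale a (kend_scale b f) = kend_scale (a * b) f.
Proof. by rewrite /kend_scale rmorphM mulrA. Qed.
Fact kend_scale1 : left_id 1 kend_scale.
Proof. by move=> f; rewrite /kend_scale rmorph1 mul1r. Qed.
Fact kend_scaleDr : right_distributive kend_scale +%R.
Proof. by move=> a f g; rewrite /kend_scale mulrDr. Qed.
Fact kend_scaleDl f : {morph kend_scale^~ f : a b / a + b}.
Proof. by move=> a b; rewrite /kend_scale rmorphD mulrDl. Qed.

HB.instance Definition _ := GRing.Zmodule_isLmodule.Build A End
  kend_scaleA kend_scale1 kend_scaleDr kend_scaleDl.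

End Endomorphisms.

(* -------------------------------------------------------------------- *)
Section Derivations.
Variables (k A : comPzRingType) (kA : {rmorphism k -> A}).

Definition leibniz : {pred kend kA A^o} := fun d =>
  `[< forall x y : A, d (x * y) = d x * y + x * d y >].

Record der := Der { der_end :> kend kA A^o; _ : der_end \in leibniz }.

HB.instance Definition _ := [isSub for der_end].
HB.instance Definition _ := [Choice of der by <:].

Lemma derM (d : der) (x y : A) : d (x * y) = d x * y + x * d y.
Proof. by case: d => d /= hd; move/asboolP: hd; apply. Qed.

Fact leibniz_submod_closed : submod_closed leibniz.
Proof.
split=> [|a d d' /asboolP hd /asboolP hd']; apply/asboolP => x y /=.
  by rewrite mul0r mulr0 addr0.
rewrite hd hd' -![_ *: _]/(_ * _) mulrDr mulrDl mulrDr !mulrA [x * a]mulrC.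
by rewrite addrACA.
Qed.

HB.instance Definition _ :=
  GRing.isSubmodClosed.Build A (kend kA A^o) leibniz leibniz_submod_closed.
HB.instance Definition _ := [SubChoice_isSubLmodule of der by <:].

Fact der_bracket_subproof (d d' : der) :
  der_end d * der_end d' - der_end d' * der_end d \in leibniz.
Proof.
have aux (u v w z u' z' : A) :
    (u + v) + (w + z) - ((u' + w) + (v + z')) = (u - u') + (z - z').
  rewrite [v + z']addrC [w + z]addrC addrACA [u' + w + _]addrACA [w + v]addrC.
  by rewrite [u' + z' + _]addrC addrKA opprD addrACA.
by apply/asboolP => x y /=; rewrite !derM !kendD !derM aux mulrBl mulrBr.
Qed.

Definition der_bracket (d d' : der) : der := Der (der_bracket_subproof d d').

End Derivations.

(* -------------------------------------------------------------------- *)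
Section HasseSchmidt.
Variables (k A : comPzRingType) (kA : {rmorphism k -> A}).

(* HS^p_k(A; Delta), as a subset of End_k(A)[[s]]_Delta *)
Definition HS p (Delta : coideal p) (D : tseries (kend kA A^o) Delta) : Prop :=
  D 0%MM = 1 /\
  forall a, Delta a -> forall x y : A,
    D a (x * y) =
    \sum_(b : 'X_{1..p < (mdeg a).+1, (mdeg a).+1} | a == (b.1 + b.2)%MM)
      D b.1 x * D b.2 y.

(* [HS_map] stands for a family of maps HS^p_k(A; Delta) -> U^p(R; Delta), given
   as total functions whose values outside HS^p_k(A; Delta) are unconstrained
   and irrelevant. HS is stable under products and substitutions, so [HS_mapM]
   and [HS_map_subst] only involve values on HS. *)
Record HS_structure (R : algOver kA) := HSStructure {
  HS_map :> forall p (Delta : coideal p),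
    tseries (kend kA A^o) Delta -> tseries R Delta;
  HS_map0 : forall p (Delta : coideal p) (D : tseries (kend kA A^o) Delta),
    HS D -> HS_map D 0%MM = 1;
  HS_mapM : forall p (Delta : coideal p) (D D' : tseries (kend kA A^o) Delta),
    HS D -> HS D' -> HS_map (D * D') = HS_map D * HS_map D';
  HS_map_comm : forall p (Delta : coideal p) (D : tseries (kend kA A^o) Delta),
    HS D -> forall a : A,
    HS_map D * tconst (iota R a) =
    trunc Delta (fun b => iota R (D b a)) * HS_map D;
  HS_map_subst : forall p (Delta : coideal p) q (Omega : coideal q)
      (phi : subst_map A Delta Omega) (D : tseries (kend kA A^o) Delta),
    HS D ->
    HS_map (subst_series (R := endAlg kA A^o) phi D) = subst_series phi (HS_map D)
}.

Definition lr_admissible (R : algOver kA) (nabla : der kA -> R) : Prop :=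
  [/\ forall (a : A) (d d' : der kA),
        nabla (a *: d + d') = iota R a * nabla d + nabla d',
      forall (d : der kA) (a : A),
        nabla d * iota R a = iota R a * nabla d + iota R (d a)
    & forall d d' : der kA,
        nabla (der_bracket d d') = nabla d * nabla d' - nabla d' * nabla d].

Fact coideal01_down (a b : 'X_{1..1}) : (mdeg a <= 1)%N -> (b <= a)%MM ->
  (mdeg b <= 1)%N.
Proof.
by move=> a1 leba; apply: leq_trans a1; rewrite -(submK leba) mdegD leq_addl.
Qed.
Fact coideal01_neq0 : exists a : 'X_{1..1}, (mdeg a <= 1)%N.
Proof. by exists 0%MM; rewrite mdeg0. Qed.

(* {0, 1}, as a co-ideal of N = N^1 *)
Definition coideal01 : coideal 1 := Coideal coideal01_down coideal01_neq0.

End HasseSchmidt.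

Section Modules.
Variables (k A : comPzRingType) (kA : {rmorphism k -> A}) (E : lmodType A).

Definition left_HS_structure := HS_structure (endAlg kA E).
Definition right_HS_structure := HS_structure (endOppAlg kA E).

Definition left_integrable_connection (nabla : der kA -> kend kA E) : Prop :=
  lr_admissible (R := endAlg kA E) nabla.
Definition right_integrable_connection (nabla : der kA -> (kend kA E)^c) : Prop :=
  lr_admissible (R := endOppAlg kA E) nabla.

End Modules.

(* Main.v *)
(** A derivation delta gives the Hasse-Schmidt derivation 1 + delta s over
    {0, 1}, and nabla delta is the coefficient of s in its image under Psi.
    Additivity of nabla comes from (1 + delta s)(1 + delta' s) =
    1 + (delta + delta') s, A-linearity from the substitution s |-> a s, and
    the Leibniz rule from the commutation axiom.  For brackets, the
    substitutions s |-> t1, s |-> t2 and s |-> t1 t2 into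
    A[[t1, t2]]/(t1^2, t2^2) carry the identity
      (1 + [x, y] t1 t2) (1 + y t2) (1 + x t1) = (1 + x t1) (1 + y t2)
    from End_k(A) to R. *)
From HB Require Import structures.
Require Import Defs.
From mathcomp Require Import all_boot all_order all_algebra.
From mathcomp Require Import boolp ssrAC mpoly zify.

Set Implicit Arguments.
Unset Strict Implicit.
Unset Printing Implicit Defensive.

Import GRing.Theory.
Local Open Scope ring_scope.

(** * Truncated series with a single term, and their products *)

Definition tterm (M : zmodType) p (Delta : coideal p) (c : 'X_{1..p}) (m : M) :
    tseries M Delta :=
  trunc Delta (fun b => if b == c then m else 0).

Arguments tterm : simpl never.

Section Terms.
Variables (M : zmodType) (p : nat) (Delta : coideal p).
Implicit Types (m : M) (a c : 'X_{1..p}).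

Lemma ttermE c m a : Delta a -> tterm Delta c m a = if a == c then m else 0.
Proof. exact: truncE. Qed.

Lemma tterm_id c m : Delta c -> tterm Delta c m c = m.
Proof. by move=> dc; rewrite ttermE // eqxx. Qed.

Lemma tconstE m : tconst m = tterm Delta 0%MM m.
Proof. by []. Qed.

(** Products of terms are killed through this lemma, which carries relations such as [t1^2 = 0]. *)
Lemma tterm_out c m : ~ Delta c -> tterm Delta c m = 0.
Proof.
move=> ndc; apply: tseriesP => a da; rewrite ttermE // tcoef0.
by case: eqP => // e; rewrite e in da.
Qed.

Lemma ttermD c m m' : tterm Delta c (m + m') = tterm Delta c m + tterm Delta c m'.
Proof.
apply: tseriesP => a da; rewrite tcoefD !ttermE //.
by case: eqP; rewrite ?addr0.
Qed.

Lemma tterm0 c : tterm Delta c (0 : M) = 0.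
Proof. by apply: tseriesP => a da; rewrite ttermE // tcoef0 if_same. Qed.

Lemma coideal0 : Delta 0%MM.
Proof.
have [a da] := coideal_neq0 Delta.
by apply: coideal_down da _; apply/mnm_lepP => i; rewrite mnm0E.
Qed.

End Terms.

Section TermProducts.
Variables (R : pzRingType) (p : nat) (Delta : coideal p).
Implicit Types (x y n : R) (c e : 'X_{1..p}).

Lemma ttermM c e x y :
  tterm Delta c x * tterm Delta e y = tterm Delta (c + e)%MM (x * y).
Proof.
apply: tseriesP => a da; rewrite tcoefM // ttermE //.
rewrite -/(conv (tterm Delta c x) (tterm Delta e y) a).
rewrite (eq_conv (f' := fun b => if b == c then x else 0)
  (g' := fun b => if b == e then y else 0) da); try by move=> b; exact: ttermE.
rewrite (@conv_lin _ _ _ _ _ (mdeg a).+1) //.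
case: eqP => [->|ne].
  have pc : (mdeg c < (mdeg (c + e)).+1)%N by rewrite ltnS mdegD leq_addr.
  have ec : (c + e - c)%MM = e by rewrite addmC addmK.
  rewrite (bigD1 (BMultinom pc)) ?lem_addr //= ec !eqxx big1 ?addr0 //.
  by move=> b /andP[_]; rewrite bmeqP /= => /negbTE ->; rewrite mul0r.
rewrite big1 // => b leba; case: eqP => [eb|_]; last by rewrite mul0r.
case: eqP => [ee|_]; last by rewrite mulr0.
by case: ne; rewrite -eb -ee addmC submK.
Qed.

(** After expansion both sides share [1], the [c] term and the [e] term, so only the exponent
    [c + e] decides: it carries [n + y * x] on the left and [x * y] on the right. Having an
    equivalence allows passing from commutators to products in one ring and back in another. *)
Lemma commutator_terms c e x y n :
    Delta (c + e)%MM -> ~ Delta (c + c)%MM -> ~ Delta (e + e)%MM ->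
  ((1 + tterm Delta (c + e)%MM n) * (1 + tterm Delta e y)
     * (1 + tterm Delta c x) = (1 + tterm Delta c x) * (1 + tterm Delta e y))
  <-> n = x * y - y * x.
Proof.
move=> dce ncc nee.
have out1 : ~ Delta (c + e + e)%MM.
  by move=> h; apply: nee; apply: coideal_down h _; rewrite -addmA addmC lem_addr.
have out2 : ~ Delta (c + e + c)%MM.
  move=> h; apply: ncc; apply: coideal_down h _.
  by rewrite [(c + e)%MM]addmC -addmA addmC lem_addr.
have -> : (1 + tterm Delta (c + e)%MM n) * (1 + tterm Delta e y) * (1 + tterm Delta c x)
        = 1 + tterm Delta c x + tterm Delta e y + tterm Delta (c + e)%MM (n + y * x).
  rewrite (mulrDl 1) mul1r (mulrDr (tterm _ _ n)) mulr1 ttermM (tterm_out _ out1) addr0.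
  rewrite mulrDr mulr1 !mulrDl mul1r !ttermM (tterm_out _ out2) addr0.
  rewrite [(e + c)%MM]addmC.
  by rewrite ttermD (AC (3*2) ((1*4*2)*(3*5))).
rewrite mulrDl mul1r mulrDr mulr1 ttermM (AC (2*2) ((1*3*2)*4)).
split=> [/addrI/(congr1 (fun r : tseries R Delta => r (c + e)%MM))|->].
  by rewrite !tterm_id // => <-; rewrite addrK.
by rewrite subrK.
Qed.

End TermProducts.

(** * Action of substitution maps on series *)

Section Substitutions.
Variables (k A : comPzRingType) (kA : {rmorphism k -> A}) (R : algOver kA).

Lemma subst_seriesD p (Delta : coideal p) q (Omega : coideal q)
    (phi : subst_map A Delta Omega) (r r' : tseries R Delta) :
  subst_series phi (r + r') = subst_series phi r + subst_series phi r'.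
Proof.
apply: tseriesP => b ob; rewrite tcoefD !truncE // -big_split.
by apply: eq_bigr => a _; rewrite tcoefD mulrDr.
Qed.

(** The sum defining [subst_series] stops at degree [mdeg b]. If [e] lies beyond that bound,
    [subst_monom_eq0] makes the right-hand side zero too; otherwise [e] is the only index that
    contributes. *)
Lemma subst_series_term p (Delta : coideal p) q (Omega : coideal q)
    (phi : subst_map A Delta Omega) e (m : R) b : Delta e -> Omega b ->
  subst_series phi (tterm Delta e m) b = Defs.iota R (phi (tmonom e) b) * m.
Proof.
move=> de ob; rewrite truncE //.
have vanish (a : 'X_{1..p}) : a != e -> tterm Delta e m a = 0.
  move=> nae; case: (pselect (Delta a)) => da; last exact: tcoef_out.
  by rewrite ttermE // (negbTE nae).
have [ltbe|leeb] := ltnP (mdeg b) (mdeg e).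
  rewrite subst_monom_eq0 // rmorph0 mul0r big1 // => a _.
  rewrite vanish ?mulr0 //; apply: contraTneq ltbe => <-.
  by rewrite -leqNgt -ltnS bmdeg.
rewrite (bigD1 (BMultinom (leeb : mdeg e < (mdeg b).+1)%N)) // tterm_id //.
rewrite big1 => [|a]; first exact: addr0.
by rewrite bmeqP => /vanish ->; rewrite mulr0.
Qed.

End Substitutions.

(** * Series over the co-ideal {0, 1} *)

Local Notation s1 := (U_(ord0 : 'I_1))%MM.

Lemma coideal01P (a : 'X_{1..1}) : coideal01 a -> a = 0%MM \/ a = s1.
Proof.
rewrite /= mdegE big_ord_recl big_ord0 addn0.
case ea: (a ord0) => [|[|n]] // _; [left | right];
  by apply/mnmP => i; rewrite ord1 ea ?mnm0E ?mnm1E.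
Qed.

Lemma coideal01_var : coideal01 s1.
Proof. by rewrite /= mdeg1. Qed.

Lemma tseries01E (M : zmodType) (f : tseries M coideal01) :
  f = tterm _ 0%MM (f 0%MM) + tterm _ s1 (f s1).
Proof.
apply: tseriesP => a da; rewrite tcoefD !ttermE //.
have [ne0 ne1] : (0%MM == s1) = false /\ (s1 == 0%MM) = false.
  by rewrite eq_sym -mdeg_eq0 mdeg1.
by case: (coideal01P da) => ->; rewrite eqxx ?ne0 ?ne1 ?addr0 ?add0r.
Qed.

(** This is the multiplication of dual numbers: the square of [s] vanishes. *)
Lemma mul_tseries01 (R : pzRingType) (f g : tseries R coideal01) :
  (f * g) 0%MM = f 0%MM * g 0%MM /\
  (f * g) s1 = f 0%MM * g s1 + f s1 * g 0%MM.
Proof.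
have out2 : ~ coideal01 (s1 + s1)%MM by rewrite /= mdegD mdeg1.
have -> : f * g = tterm _ 0%MM (f 0%MM * g 0%MM)
                  + tterm _ s1 (f 0%MM * g s1 + f s1 * g 0%MM).
  rewrite {1}(tseries01E f) {1}(tseries01E g) mulrDl !mulrDr !ttermM.
  by rewrite (tterm_out _ out2) !addm0 !add0m addr0 ttermD addrA.
have ne : (s1 == 0%MM) = false by rewrite -mdeg_eq0 mdeg1.
have ne' : (0%MM == s1) = false by rewrite eq_sym.
by split; rewrite tcoefD !ttermE ?eqxx ?ne ?ne' ?addr0 ?add0r //;
  try exact: coideal0; exact: coideal01_var.
Qed.

Lemma coef_1tterm (R : pzRingType) (m : R) :
  (1 + tterm coideal01 s1 m) 0%MM = 1 /\ (1 + tterm coideal01 s1 m) s1 = m.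
Proof.
have ne : (s1 == 0%MM) = false by rewrite -mdeg_eq0 mdeg1.
rewrite !tcoefD -[1 : tseries R coideal01]/(tterm _ 0%MM 1).
rewrite !tterm_id; try exact: coideal0; try exact: coideal01_var.
rewrite !ttermE; try exact: coideal0; try exact: coideal01_var.
by rewrite [0%MM == _]eq_sym ne addr0 add0r.
Qed.

(** * Substitution of a single term for [s] *)

Section TermSubstitution.
Variables (A : comPzRingType) (q : nat) (Omega : coideal q) (c : 'X_{1..q}).
Hypotheses (c_neq0 : c != 0%MM) (c2_out : ~ Omega (c + c)%MM).

(** This is the substitution [s |-> a t^c]. It is multiplicative because [t^(c + c)] vanishes in the
    target, and [c != 0] gives the image of [s] a zero constant term. *)
Lemma term_subst_exists (a : A) : exists phi : subst_map A coideal01 Omega,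
  forall f, phi f = tterm _ 0%MM (f 0%MM) + tterm _ c (a * f s1).
Proof.
pose h (f : tseries A coideal01) : tseries A Omega :=
  tterm _ 0%MM (f 0%MM) + tterm _ c (a * f s1).
have ne : (s1 == 0%MM) = false by rewrite -mdeg_eq0 mdeg1.
have hD : {morph h : f g / f + g}.
  by move=> f g; rewrite /h !tcoefD mulrDr !ttermD addrACA.
have hB : {morph h : f g / f - g}.
  by move=> f g; apply: (addIr (h g)); rewrite -hD !subrK.
have h_const x : h (tconst x) = tconst x.
  rewrite /h !tconstE !ttermE ?eqxx ?ne ?mulr0 ?tterm0 ?addr0 //.
    exact: coideal01_var.
  exact: coideal0.
have hM : monoid_morphism h.
  split=> [|f g]; first exact: h_const.
  have [e0 e1] := mul_tseries01 f g.
  rewrite /h e0 e1 mulrDl !mulrDr !ttermM (tterm_out _ c2_out) !addm0 !add0m addr0.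
  by rewrite ttermD addrA [a * (f 0%MM * _)]mulrCA [a * (f s1 * _)]mulrA.
pose hZ := GRing.isZmodMorphism.Build _ _ h hB.
pose hR := GRing.isMonoidMorphism.Build _ _ h hM.
pose H : {rmorphism tseries A coideal01 -> tseries A Omega} := HB.pack h hZ hR.
have h_var i : H (tvar i) 0%MM = 0.
  rewrite -[LHS]/(h (tvar i) 0%MM) /h tcoefD !(ttermE _ _ (@coideal0 _ Omega)).
  rewrite eqxx [0%MM == c]eq_sym (negbTE c_neq0) addr0 truncE; last exact: coideal0.
  by rewrite eq_sym -mdeg_eq0 mdeg1.
by exists (@SubstMap _ _ _ _ _ H h_const h_var).
Qed.

(** Only the images of [1] and [s] under [phi] enter, and these are [1] and [a t^c]. *)
Lemma subst_series01 (k : comPzRingType) (kA : {rmorphism k -> A})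
    (R : algOver kA) (phi : subst_map A coideal01 Omega) (a : A) (m : R) :
    (forall f, phi f = tterm _ 0%MM (f 0%MM) + tterm _ c (a * f s1)) ->
  subst_series phi (1 + tterm _ s1 m) = 1 + tterm _ c (Defs.iota R a * m).
Proof.
move=> phiE; rewrite subst_seriesD; apply: tseriesP => b ob; rewrite !tcoefD.
rewrite -[1 : tseries R coideal01]/(tterm _ 0%MM 1).
rewrite !subst_series_term //; [|exact: coideal0|exact: coideal01_var].
have -> : tmonom 0%MM = 1 :> tseries A coideal01 by [].
rewrite rmorph1 phiE tcoefD -[tmonom s1]/(tterm _ s1 1) tterm_id.
  rewrite mulr1 mulr1 !ttermE //; last exact: coideal0.
  have ne : (0%MM == s1) = false by rewrite eq_sym -mdeg_eq0 mdeg1.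
  rewrite ne if_same add0r.
  by congr (_ + _); case: eqP; rewrite ?rmorph1 ?rmorph0 ?mul0r.
exact: coideal01_var.
Qed.

End TermSubstitution.

(** * Hasse-Schmidt derivations built from derivations *)

Section DerivationSeries.
Variables (k A : comPzRingType) (kA : {rmorphism k -> A}).

(** The Leibniz condition on [D] says that [F], sending [x] to the series of all [D a x], is
    multiplicative. All second-order terms of [F x * F y] fall outside [Delta], and the first-order
    ones match by the Leibniz rule for [d] and [d']. *)
Lemma HS_terms p (Delta : coideal p) c c' (d d' : der kA) :
    c != 0%MM -> c' != 0%MM ->
    ~ Delta (c + c)%MM -> ~ Delta (c + c')%MM -> ~ Delta (c' + c')%MM ->
  HS (1 + tterm Delta c (der_end d) + tterm Delta c' (der_end d')).
Proof.
move=> c_neq0 c'_neq0 cc cc' c'c'; set D := 1 + _ + _.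
pose F x : tseries A Delta := tterm _ 0%MM x + tterm _ c (d x) + tterm _ c' (d' x).
have FE a x : D a x = F x a.
  case: (pselect (Delta a)) => da; last by rewrite !tcoef_out.
  rewrite /D /F !tcoefD !ttermE //=.
  by congr (_ + _ + _); case: eqP.
have FM x y : F (x * y) = F x * F y.
  rewrite /F !mulrDl !mulrDr !ttermM (tterm_out _ cc) (tterm_out _ cc').
  rewrite [(c' + c)%MM]addmC (tterm_out _ cc') (tterm_out _ c'c').
  rewrite !add0m !addm0 !addr0 !derM !ttermD.
  by rewrite !addrA (AC 5 (1*3*5*2*4)) /= (AC 5 (1*4*2*5*3)).
split; first last.
  by move=> a da x y; rewrite FE FM tcoefM //; apply: eq_bigr => b _; rewrite !FE.
rewrite /D !tcoefD !ttermE; try exact: coideal0.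
by rewrite eqxx !(eq_sym 0%MM) (negbTE c_neq0) (negbTE c'_neq0) !addr0.
Qed.

Lemma HS_term p (Delta : coideal p) c (d : der kA) :
  c != 0%MM -> ~ Delta (c + c)%MM -> HS (1 + tterm Delta c (der_end d)).
Proof.
(* The second term is the zero derivation placed at the same exponent, so all its side conditions
   are those on [c]. *)
move=> c_neq0 cc; have := HS_terms d 0 c_neq0 c_neq0 cc cc cc.
by rewrite /= tterm0 addr0.
Qed.

End DerivationSeries.

(** Links the form [m s] used in the theorem to single terms. *)
Lemma tconst_var (R : pzRingType) (m : R) :
  tconst m * tvar ord0 = tterm coideal01 s1 m.
Proof. by rewrite -[LHS]/(tterm _ _ _ * tterm _ _ _) ttermM add0m mulr1. Qed.

(** * The square co-ideal in two variables *)

Fact square_down (a b : 'X_{1..2}) :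
  (a <= U_(ord0) + U_(ord_max))%MM -> (b <= a)%MM ->
  (b <= U_(ord0) + U_(ord_max))%MM.
Proof. by move=> h /lepm_trans; apply. Qed.

Fact square_neq0 : exists a : 'X_{1..2}, (a <= U_(ord0) + U_(ord_max))%MM.
Proof. by exists (U_(ord0) + U_(ord_max))%MM; apply: lepm_refl. Qed.

(** This is [{0, 1}^2]: it excludes both squares but keeps [t1 t2], where the commutator appears. *)
Definition coideal_square : coideal 2 := Coideal square_down square_neq0.

Lemma square_out i : ~ coideal_square (U_(i) + U_(i))%MM.
Proof.
move=> /= /mnm_lepP/(_ i); rewrite !mnmDE !mnm1E eqxx.
by case: i => [[|[|]]].
Qed.

(** * The connection attached to an HS-structure *)

Section Connection.
Variables (k A : comPzRingType) (kA : {rmorphism k -> A}) (R : algOver kA).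
Variable Psi : HS_structure R.

Let nabla (d : der kA) : R := Psi 1%N coideal01 (1 + tterm _ s1 (der_end d)) s1.

Let s1_neq0 : s1 != 0%MM. Proof. by rewrite -mdeg_eq0 mdeg1. Qed.
Let s1_out : ~ coideal01 (s1 + s1)%MM. Proof. by rewrite /= mdegD mdeg1. Qed.

Lemma HS_map01 d :
  Psi _ coideal01 (1 + tterm _ s1 (der_end d)) = 1 + tterm _ s1 (nabla d).
Proof. by rewrite [LHS]tseries01E HS_map0 //; exact: HS_term. Qed.

(** Compatibility of [Psi] with [s |-> a t^c]. The case of {0, 1} yields [A]-linearity, and [a = 1]
    moves [nabla d] to any exponent needed for the bracket. *)
Lemma HS_map_term q (Omega : coideal q) c (a : A) d :
    c != 0%MM -> ~ Omega (c + c)%MM ->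
  Psi _ Omega (1 + tterm _ c (der_end (a *: d)))
  = 1 + tterm _ c (Defs.iota R a * nabla d).
Proof.
move=> c_neq0 cc; have [phi phiE] := term_subst_exists c_neq0 cc a.
have hd : HS (1 + tterm coideal01 s1 (der_end d)) by exact: HS_term.
have := HS_map_subst Psi phi hd.
by rewrite (subst_series01 _ phiE) HS_map01 (subst_series01 _ phiE).
Qed.

Lemma HS_map_term1 q (Omega : coideal q) c d :
    c != 0%MM -> ~ Omega (c + c)%MM ->
  Psi _ Omega (1 + tterm _ c (der_end d)) = 1 + tterm _ c (nabla d).
Proof. by move=> h /(HS_map_term 1 d h); rewrite scale1r rmorph1 mul1r. Qed.

Lemma nabla_admissible : lr_admissible nabla.
Proof.
split=> [a d d'|d a|d d'].
- have termD (Q : pzRingType) (x y : Q) :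
      (1 + tterm coideal01 s1 x) * (1 + tterm coideal01 s1 y)
      = 1 + tterm coideal01 s1 (x + y).
    rewrite mulrDl mul1r mulrDr mulr1 ttermM (tterm_out _ s1_out) addr0.
    by rewrite ttermD (AC (2*1) (1*3*2)) addrA.
  have := HS_mapM Psi (HS_term (a *: d) s1_neq0 s1_out) (HS_term d' s1_neq0 s1_out).
  (* The sum of endomorphisms is convertible to the one underlying [a *: d + d'], so [HS_map01]
     applies to it. *)
  rewrite HS_map_term // HS_map01 !termD -[_ + der_end d']/(der_end (a *: d + d')).
  rewrite HS_map01 => /addrI/(congr1 (fun r : tseries R coideal01 => r s1)).
  by rewrite !tterm_id //; exact: coideal01_var.
- have := HS_map_comm Psi (HS_term d s1_neq0 s1_out) a.
  rewrite HS_map01 tconstE => /(congr1 (fun r : tseries R coideal01 => r s1)).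
  have [_ ->] := mul_tseries01 (1 + tterm coideal01 s1 (nabla d))
                              (tterm coideal01 0%MM (Defs.iota R a)).
  (* [D] has coefficients [a] and [d a], viewed in [R]. *)
  set D := trunc _ _; have [_ ->] := mul_tseries01 D (1 + tterm coideal01 s1 (nabla d)).
  have [-> ->] := coef_1tterm (nabla d).
  rewrite [D s1]truncE ?[D 0%MM]truncE; try exact: coideal0; try exact: coideal01_var.
  have [-> ->] := coef_1tterm (der_end d).
  rewrite tterm_id; last exact: coideal0.
  rewrite ttermE ?(negbTE s1_neq0) //; last exact: coideal01_var.
  by rewrite mulr0 add0r mulr1.
- set c : 'X_{1..2} := U_(ord0)%MM; set e : 'X_{1..2} := U_(ord_max)%MM.
  have c_neq0 : c != 0%MM by rewrite -mdeg_eq0 mdeg1.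
  have e_neq0 : e != 0%MM by rewrite -mdeg_eq0 mdeg1.
  have ce_neq0 : (c + e)%MM != 0%MM by rewrite -mdeg_eq0 mdegD !mdeg1.
  have cc : ~ coideal_square (c + c)%MM by exact: square_out.
  have ee : ~ coideal_square (e + e)%MM by exact: square_out.
  (* Since [f] is below [c + e], the exponent [f + (c + e)] dominates [f + f]. *)
  have out f : ~ coideal_square (f + f)%MM -> (f <= c + e)%MM ->
      ~ coideal_square (f + (c + e))%MM.
    move=> ff /mnm_lepP fle h; apply: ff; apply: coideal_down h _.
    by apply/mnm_lepP => i; rewrite [in leqRHS]mnmDE mnmDE leq_add2l.
  have cce : ~ coideal_square (c + (c + e))%MM by apply: out; rewrite ?lem_addr.
  have ece : ~ coideal_square (e + (c + e))%MM.
    by apply: out; rewrite // addmC lem_addr.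
  have cece : ~ coideal_square (c + e + (c + e))%MM.
    move=> h; apply: cce; apply: coideal_down h _.
    by apply/mnm_lepP => i; rewrite !mnmDE; lia.
  have dce : coideal_square (c + e)%MM by exact: lepm_refl.
  have hC : HS (1 + tterm coideal_square (c + e)%MM (der_end (der_bracket d d'))).
    exact: HS_term.
  have hD := HS_term d c_neq0 cc; have hD' := HS_term d' e_neq0 ee.
  (* [HS_mapM] on the triple product needs its first two factors to form a Hasse-Schmidt derivation.
     Their cross term vanishes, which leaves two terms as in [HS_terms]. *)
  have hCD' : HS ((1 + tterm coideal_square (c + e)%MM (der_end (der_bracket d d')))
                  * (1 + tterm coideal_square e (der_end d'))).
    rewrite mulrDl mul1r mulrDr mulr1 ttermM [(c + e + e)%MM]addmC.
    by rewrite (tterm_out _ ece) addr0; exact: HS_terms.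
  (* In [R], the bracket formula is reduced to an identity of products. Once both sides are values
     of [Psi], the same lemma in [End_k(A)] reduces that identity to the definition of
     [der_bracket]. *)
  apply/(commutator_terms _ _ _ dce cc ee).
  rewrite -!HS_map_term1 // -!HS_mapM //; congr (Psi _ _ _).
  exact/(commutator_terms _ _ _ dce cc ee).
Qed.

(** Working over an arbitrary [R] covers [End_k(E)] and its opposite at once. Uniqueness holds
    because the formula fixes the coefficient of [s]. *)
Lemma HS_connection : exists! nabla' : der kA -> R,
  lr_admissible nabla' /\
  forall d : der kA,
    Psi _ coideal01 (1 + tconst (der_end d) * tvar ord0)
    = 1 + tconst (nabla' d) * tvar ord0.
Proof.
exists nabla; split=> [|nabla' [_ Psi_nabla']].
  by split=> [|d]; [exact: nabla_admissible | rewrite !tconst_var HS_map01].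
apply/funext => d; have := Psi_nabla' d; rewrite !tconst_var HS_map01.
move=> /addrI/(congr1 (fun r : tseries R coideal01 => r s1)).
by rewrite !tterm_id //; exact: coideal01_var.
Qed.

End Connection.

Theorem corollary2p1p8 (k A : comPzRingType) (kA : {rmorphism k -> A})
    (E : lmodType A) :
  (forall Psi : left_HS_structure kA E,
     exists! nabla : der kA -> kend kA E,
       left_integrable_connection nabla /\
       forall delta : der kA,
         Psi 1%N coideal01 (1 + tconst (der_end delta) * tvar ord0) =
         1 + tconst (nabla delta) * tvar ord0) /\
  (forall Psi : right_HS_structure kA E,
     exists! nabla : der kA -> (kend kA E)^c,
       right_integrable_connection nabla /\
       forall delta : der kA,
         Psi 1%N coideal01 (1 + tconst (der_end delta) * tvar ord0) =
         1 + tconst (nabla delta) * tvar ord0).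
Proof.
split=> Psi; first exact: (HS_connection Psi).
exact: (HS_connection Psi).
Qed.
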